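(* Let $F:\mathrm{Set}\to\mathrm{Set}$ be a functor that preserves monomorphisms. The following are equivalent: (1) $F$ weakly preserves kernel pairs. (2) $F$ weakly preserves pullbacks of epis, i.e. pullbacks of pairs of surjective maps $f_1:A_1\to C$, $f_2:A_2\to C$.
   Context: The axiom of choice is assumed. A kernel pair is a pullback of a map with itself. A functor $F$ weakly preserves a pullback $(P,p_1,p_2)$ of $f_1:A_1\to C$ and $f_2:A_2\to C$ if $(F(P),Fp_1,Fp_2)$ is a weak pullback of $Ff_1$ and $Ff_2$; in $\mathrm{Set}$ this means that for all $u_1\in F(A_1)$, $u_2\in F(A_2)$ with $(Ff_1)u_1=(Ff_2)u_2$ there is some $w\in F(P)$ with $(Fp_1)w=u_1$ and $(Fp_2)w=u_2$. $F$ weakly preserves kernel pairs (pullbacks of epis) if it weakly preserves every pullback of the respective kind. *)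

(* Defs.v *)
From mathcomp Require Import ssreflect ssrfun.

Set Implicit Arguments.
Unset Strict Implicit.
Unset Printing Implicit Defensive.

(* The category Set: objects are the types of one fixed universe, morphisms are
   Rocq functions.  Naming the universe once keeps the source and target of an
   endofunctor, and the test objects of all universal properties, at the same
   level. *)
Definition SET := Type.

Record functor := Functor {
  fobj :> SET -> SET;
  fmap : forall A B : SET, (A -> B) -> fobj A -> fobj B;
  fmap_id : forall A : SET, fmap (@id A) = @id (fobj A);
  fmap_comp : forall (A B C : SET) (g : B -> C) (f : A -> B),
    fmap (g \o f) = fmap g \o fmap f
}.

Arguments fmap F {A B} f : rename.

Definition monomorphism (A B : SET) (f : A -> B) : Prop :=
  forall (X : SET) (g h : X -> A), f \o g = f \o h -> g = h.

Definition surjective (A B : SET) (f : A -> B) : Prop :=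
  forall b : B, exists a : A, f a = b.

Section Pullbacks.

Variables (A1 A2 C P : SET).
Variables (f1 : A1 -> C) (f2 : A2 -> C) (p1 : P -> A1) (p2 : P -> A2).

Definition is_pullback : Prop :=
  f1 \o p1 = f2 \o p2 /\
  forall (X : SET) (q1 : X -> A1) (q2 : X -> A2), f1 \o q1 = f2 \o q2 ->
    exists! h : X -> P, p1 \o h = q1 /\ p2 \o h = q2.

Definition is_weak_pullback : Prop :=
  f1 \o p1 = f2 \o p2 /\
  forall (X : SET) (q1 : X -> A1) (q2 : X -> A2), f1 \o q1 = f2 \o q2 ->
    exists h : X -> P, p1 \o h = q1 /\ p2 \o h = q2.

End Pullbacks.

Definition preserves_monomorphisms (F : functor) : Prop :=
  forall (A B : SET) (f : A -> B), monomorphism f -> monomorphism (fmap F f).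

Definition weakly_preserves_pullback (F : functor) (A1 A2 C P : SET)
    (f1 : A1 -> C) (f2 : A2 -> C) (p1 : P -> A1) (p2 : P -> A2) : Prop :=
  is_weak_pullback (fmap F f1) (fmap F f2) (fmap F p1) (fmap F p2).

Definition weakly_preserves_kernel_pairs (F : functor) : Prop :=
  forall (A C P : SET) (f : A -> C) (p1 p2 : P -> A),
    is_pullback f f p1 p2 -> weakly_preserves_pullback F f f p1 p2.

Definition weakly_preserves_pullbacks_of_epis (F : functor) : Prop :=
  forall (A1 A2 C P : SET) (f1 : A1 -> C) (f2 : A2 -> C)
         (p1 : P -> A1) (p2 : P -> A2),
    surjective f1 -> surjective f2 ->
    is_pullback f1 f2 p1 p2 -> weakly_preserves_pullback F f1 f2 p1 p2.

(* Main.v *)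
Require Import Defs.
From mathcomp Require Import ssreflect ssrfun.
From mathcomp Require Import boolp.

(* (1) => (2): put [f = [f1, f2] : A1 + A2 -> C].  Elements [u1], [u2] with
   [F f1 u1 = F f2 u2], pushed into [F (A1 + A2)], lift to some [w] over the
   kernel pair [K] of [f].  Since [f1] is onto, the injection [A1 -> A1 + A2] has
   a retraction over [C] (use a section of [f1] on [A2]); likewise for [A2].  The
   two retractions induce a map from [K] to the pullback of [f1] and [f2], and the
   image of [w] under it projects to [u1] and [u2].
   (2) => (1): factor [f = m \o e] through its image.  A kernel pair of [f] is one
   of the epi [e], and postcomposing with the mono [F m] keeps it weak. *)

(** The trailing [h] plays the part of a generalized element of [F A], so that functoriality
    rewrites inside longer composites. *)
Lemma fmap_compE (F : functor) (A B C : SET) (g : B -> C) (f : A -> B)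
    (X : SET) (h : X -> F A) : fmap F (g \o f) \o h = fmap F g \o (fmap F f \o h).
Proof. by rewrite fmap_comp. Qed.

Lemma surjective_section {A B : SET} {f : A -> B} :
  surjective f -> exists s : B -> A, cancel s f.
Proof. by move=> /choice[s sK]; exists s. Qed.

Lemma sval_monomorphism (C : SET) (Q : C -> Prop) :
  monomorphism (fun x : {c : C | Q c} => sval x).
Proof.
move=> X g h gh; apply: funext => x; apply: eq_sig_hprop.
  by move=> c; apply: Prop_irrelevance.
exact: (congr1 (fun k : X -> C => k x) gh).
Qed.

Lemma kernel_pair_pullback (A C : SET) (f : A -> C) :
  is_pullback f f (fun x : {ab : A * A | f ab.1 = f ab.2} => (sval x).1)
                  (fun x => (sval x).2).
Proof.
split=> [|X q1 q2 q12]; first by apply: funext => -[].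
exists (fun x => exist (fun ab : A * A => f ab.1 = f ab.2) (q1 x, q2 x)
                       (congr1 (fun k : X -> C => k x) q12)).
split=> // h [h1 h2]; apply: sval_monomorphism.
by apply: funext => x /=; rewrite -h1 -h2 /= -surjective_pairing.
Qed.

(** As [m] is mono, the pairs [e1], [e2] and [m \o e1], [m \o e2] have the same cones. *)
Lemma is_pullback_mono_cancel (A1 A2 B C P : SET) (m : B -> C) (e1 : A1 -> B)
    (e2 : A2 -> B) (p1 : P -> A1) (p2 : P -> A2) :
  monomorphism m -> is_pullback (m \o e1) (m \o e2) p1 p2 ->
  is_pullback e1 e2 p1 p2.
Proof.
move=> mono_m [sq univ]; split=> [|X q1 q2 q12]; first exact: mono_m.
exact/univ/(congr1 (comp m) q12).
Qed.

Lemma is_weak_pullback_mono (A1 A2 B C P : SET) (m : B -> C) (e1 : A1 -> B)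
    (e2 : A2 -> B) (p1 : P -> A1) (p2 : P -> A2) :
  monomorphism m -> is_weak_pullback e1 e2 p1 p2 ->
  is_weak_pullback (m \o e1) (m \o e2) p1 p2.
Proof.
move=> mono_m [sq univ]; split=> [|X q1 q2 q12]; first exact: (congr1 (comp m) sq).
exact/univ/mono_m.
Qed.

Lemma preserves_epi_pullbacks (F : functor) :
  weakly_preserves_kernel_pairs F -> weakly_preserves_pullbacks_of_epis F.
Proof.
move=> Fker A1 A2 C P f1 f2 p1 p2 surj1 surj2 [sq univ].
split=> [|X u1 u2 u12]; first by rewrite -!fmap_comp sq.
have [s1 s1K] := surjective_section surj1.
have [s2 s2K] := surjective_section surj2.
pose f (a : A1 + A2) := match a with inl a1 => f1 a1 | inr a2 => f2 a2 end.
pose r1 (a : A1 + A2) := match a with inl a1 => a1 | inr a2 => s1 (f2 a2) end.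
pose r2 (a : A1 + A2) := match a with inl a1 => s2 (f1 a1) | inr a2 => a2 end.
have f1r1 a : f1 (r1 a) = f a by case: a => //= a2; rewrite s1K.
have f2r2 a : f2 (r2 a) = f a by case: a => //= a1; rewrite s2K.
pose K : SET := {ab : (A1 + A2) * (A1 + A2) | f ab.1 = f ab.2}.
have [_ Funiv] := Fker _ _ _ _ _ _ (kernel_pair_pullback _ _ f).
have [|w [w1 w2]] := Funiv X (fmap F inl \o u1) (fmap F inr \o u2).
  (* [f \o inl] and [f \o inr] compute to [f1] and [f2], which leaves [u12]. *)
  by rewrite -!fmap_compE.
have [|h [[h1 h2] _]] :=
  univ K (fun x : K => r1 (sval x).1) (fun x : K => r2 (sval x).2).
  by apply: funext => -[ab abE] /=; rewrite f1r1 f2r2.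
exists (fmap F h \o w); split; rewrite -fmap_compE.
(* [F r1] undoes [F inl], since [r1 \o inl] computes to the identity. *)
- have -> : p1 \o h = r1 \o (fun x : K => (sval x).1) by [].
  by rewrite fmap_compE w1 -fmap_compE (fmap_id F A1).
- have -> : p2 \o h = r2 \o (fun x : K => (sval x).2) by [].
  by rewrite fmap_compE w2 -fmap_compE (fmap_id F A2).
Qed.

Lemma preserves_kernel_pairs (F : functor) :
  preserves_monomorphisms F -> weakly_preserves_pullbacks_of_epis F ->
  weakly_preserves_kernel_pairs F.
Proof.
move=> Fmono Fepi A C P f p1 p2.
pose im := {c : C | exists a, f a = c}.
pose e (a : A) : im := exist _ (f a) (ex_intro _ a erefl).
pose m (c : im) : C := sval c.
have mono_m : monomorphism m by apply: sval_monomorphism.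
have surj_e : surjective e.
  (* Eliminating [fa] turns the given membership proof into the one built into [e a]. *)
  by move=> [c [a fa]]; exists a; case: c / fa.
rewrite (_ : f = m \o e) // => /(is_pullback_mono_cancel _ _ _ _ _ _ _ _ _ _ mono_m).
move=> /(Fepi _ _ _ _ _ _ _ _ surj_e surj_e) wpb.
rewrite /weakly_preserves_pullback fmap_comp.
exact: is_weak_pullback_mono (Fmono _ _ _ mono_m) wpb.
Qed.

Theorem corollary5 (F : functor) (Fmono : preserves_monomorphisms F) :
  weakly_preserves_kernel_pairs F <-> weakly_preserves_pullbacks_of_epis F.
Proof.
by split; [apply: preserves_epi_pullbacks | apply: preserves_kernel_pairs].
Qed.
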